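(* Let $G=(V,E)$ be a finite simple undirected graph with complement $G^c$. Suppose that (P2) every edge $e\in E$ lies in a unique triangle (3-cycle) of $G$, and (P3) every non-edge $e\in E^c$ lies in a unique quadrilateral (4-cycle) of $G^c$. Then $|V|<9$.
   Context: A triangle is a cycle of length 3 and a quadrilateral is a cycle of length 4, regarded as subgraphs; $G^c$ is the graph on $V$ whose edges are the pairs of distinct vertices not joined in $G$. *)

(* Defs.v *)
From mathcomp Require Import all_boot.

Set Implicit Arguments.
Unset Strict Implicit.
Unset Printing Implicit Defensive.

(* A simple graph on the finite vertex set T is a symmetric irreflexive
   adjacency relation e : rel T; an undirected edge is the set [set x; y] of
   its endpoints. *)

Section Graphs.

Variable T : finType.
Implicit Types (e : rel T) (s : seq T).

Definition edges e : {set {set T}} := [set [set p.1; p.2] | p : T * T & e p.1 p.2].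

Definition compl e : rel T := fun x y => (x != y) && ~~ e x y.

Definition cycle_edges s : {set {set T}} := [set [set x; next s x] | x in s].

(* A k-cycle subgraph is represented by its edge set, which determines it, so
   the 2k traversals of the same cycle are identified, while distinct cycles on
   the same vertices are not.  Meaningful for k >= 3 only. *)
Definition cycles e (k : nat) : {set {set {set T}}} :=
  [set C | [exists s : k.-tuple T, ucycleb e s && (C == cycle_edges s)]].

Definition in_unique_cycle e (k : nat) (f : {set T}) : Prop :=
  exists! C : {set {set T}}, C \in cycles e k /\ f \in C.

End Graphs.

(* Main.v *)
Require Import Defs.
From mathcomp Require Import all_boot.

(** Write H for the complement of G. Unique quadrilaterals force two distinct
    vertices to have at most two common H-neighbours. If x y z is a triangle of
    G and z has no further G-neighbour, every other vertex is a common
    H-neighbour of z and one of x, y, so |V| <= 3 + 2 + 2. Hence if |V| >= 8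
    there are further triangles z a a', y b b', x c c' of G. By uniqueness of
    triangles, a is H-adjacent to one of c, c', say c, and c is H-adjacent to
    one of b, b', say b. Then x a y a' and x a c b are two quadrilaterals of H
    through the edge x a. *)

Set Implicit Arguments.
Unset Strict Implicit.
Unset Printing Implicit Defensive.

(** * Reading the vertices of a cycle off its edge set *)

Lemma set2_eq (T : finType) (a b c d : T) :
  [set a; b] = [set c; d] -> a = c /\ b = d \/ a = d /\ b = c.
Proof.
move=> E.
have /set2P[ac|ad] : a \in [set c; d] by rewrite -E set21.
  have /set2P[bc|->] : b \in [set c; d] by rewrite -E set22.
    have /set2P[] : d \in [set a; b] by rewrite E set22.
      by rewrite bc ac => ->; left.
    by move=> ->; left.
  by left.
have /set2P[->|bd] : b \in [set c; d] by rewrite -E set22.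
  by right.
have /set2P[] : c \in [set a; b] by rewrite E set21.
  by rewrite ad bd => ->; right.
by move=> ->; right.
Qed.

Section CyclesInGraphs.

Variables (T : finType) (e : rel T).
Implicit Types (x y z w : T) (s t : seq T) (f : {set T}).

(** The edge is traversed either out of [x] or into [x]. This is how vertices are recovered from an
    equality of edge sets. *)
Lemma cycle_edges_next s x y : uniq s ->
  [set x; y] \in cycle_edges s -> y = next s x \/ y = prev s x.
Proof.
move=> Us /imsetP[u _ /set2_eq[[-> ->]|[-> ->]]]; first by left.
by right; rewrite prev_next.
Qed.

Lemma mem_cycle_edges s x : x \in s -> [set x; next s x] \in cycle_edges s.
Proof. by move=> xs; apply/imsetP; exists x. Qed.

Lemma mem_edges x y : e x y -> [set x; y] \in edges e.
Proof. by move=> exy; apply/imsetP; exists (x, y); rewrite ?inE. Qed.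

Lemma cycles_ucycle s : ucycleb e s -> cycle_edges s \in cycles e (size s).
Proof.
by move=> es; rewrite inE; apply/existsP; exists (in_tuple s); rewrite es /=.
Qed.

Lemma in_unique_cycle_eq k f s t : in_unique_cycle e k f ->
  ucycleb e s -> ucycleb e t -> size s = k -> size t = k ->
  f \in cycle_edges s -> f \in cycle_edges t -> cycle_edges s = cycle_edges t.
Proof.
move=> [C [_ CU]] /cycles_ucycle es /cycles_ucycle et ks kt fs ft.
rewrite ks in es; rewrite kt in et.
by rewrite -(CU _ (conj es fs)) -(CU _ (conj et ft)).
Qed.

End CyclesInGraphs.

(** * Vertex form of the unique triangle condition *)

Section UniqueTriangles.

Variables (T : finType) (e : rel T).
Hypotheses (e_sym : symmetric e) (e_irr : irreflexive e).
Hypothesis P2 : forall f : {set T}, f \in edges e -> in_unique_cycle e 3 f.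
Implicit Types x y z w : T.

Let e_neq x y : e x y -> x != y.
Proof. by apply: contraTneq => ->; rewrite e_irr. Qed.

Lemma triangle_exists x y : e x y -> exists z, e x z && e y z.
Proof.
move=> exy; have [C [[]]] := P2 (mem_edges exy).
rewrite inE => /existsP[s /andP[/andP[es Us] /eqP->]] /imsetP[u us Exy] _.
(* Rotate the triangle to start at [u]: the edge becomes its first side, and the remaining vertex is
   the witness. *)
have [i s' Es] := rot_to us.
have := size_tuple s; rewrite -(size_rot i) Es.
case: s' Es => [|v [|w []]] // Es _.
move: es; rewrite -(rot_cycle i) Es /= andbT => /and3P[euv evw ewu].
have nu : next s u = v by rewrite -(next_rot i) // Es /= eqxx.
by exists w; case/set2_eq: Exy => [[-> ->]|[-> ->]];
  rewrite nu (e_sym u) evw ewu.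
Qed.

Lemma triangle_unique x y z w :
  e x y -> e x z -> e y z -> e x w -> e y w -> z = w.
Proof.
move=> exy exz eyz exw eyw.
have ucyc v : e x v -> e y v -> ucycleb e [:: x; y; v].
  move=> exv eyv; rewrite /ucycleb /= exy eyv (e_sym v) exv !inE.
  by rewrite negb_or !e_neq.
have next_x v : next [:: x; y; v] x = y by rewrite /= eqxx.
have xy_in v : [set x; y] \in cycle_edges [:: x; y; v].
  by rewrite -{1}(next_x v) mem_cycle_edges ?mem_head.
have Ezw := in_unique_cycle_eq (P2 (mem_edges exy)) (ucyc z exz eyz)
  (ucyc w exw eyw) erefl erefl (xy_in z) (xy_in w).
(* The side from [y] to [z] also lies on the triangle [x y w], where the neighbours of [y] are only
   [w] and [x]. *)
have := @mem_cycle_edges T [:: x; y; z] y; rewrite Ezw /= !inE eqxx orbT.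
have /negPf nxy := e_neq exy.
rewrite eq_sym nxy => /(_ isT) /cycle_edges_next [].
- by have /andP[] := ucyc w exw eyw.
- by rewrite /= eq_sym nxy eqxx.
rewrite /= eqxx => zx.
by rewrite zx e_irr in exz.
Qed.

End UniqueTriangles.

(** * Vertex form of the unique quadrilateral condition *)

Section UniqueQuadrilaterals.

Variables (T : finType) (h : rel T).
Hypothesis P3 : forall f : {set T}, f \in edges h -> in_unique_cycle h 4 f.
Implicit Types x a b c : T.

(** Both cycles contain the edge [x a], so their edge sets agree. Then [b] is the neighbour of [a]
    other than [x], and [c] the neighbour of [x] other than [a]. *)
Lemma quadrilateral_unique x a b c b' c' :
  ucycleb h [:: x; a; b; c] -> ucycleb h [:: x; a; b'; c'] -> b = b' /\ c = c'.
Proof.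
move=> C C'; have /andP[/andP[hxa _] _] := C.
have xa_in v w : [set x; a] \in cycle_edges [:: x; a; v; w].
  have {1}<- : next [:: x; a; v; w] x = a by rewrite /= eqxx.
  by rewrite mem_cycle_edges ?mem_head.
have E := in_unique_cycle_eq (P3 (mem_edges hxa)) C C' erefl erefl
  (xa_in b c) (xa_in b' c').
have /andP[_ U] := C; have /andP[_ U'] := C'.
move: (U); rewrite /= !inE !negb_or -!andbA.
case/and5P=> xa xb xc ab /andP[ac /andP[bc _]].
move: (U'); rewrite /= !inE !negb_or -!andbA.
case/and5P=> _ xb' xc' ab' /andP[ac' /andP[bc' _]].
split.
  have := @mem_cycle_edges T [:: x; a; b; c] a.
  rewrite E !inE eqxx orbT => /(_ isT) /(cycle_edges_next U').
  rewrite /= !eqxx ![a == x]eq_sym (negPf xa) => -[//|].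
  by move=> bx; rewrite bx eqxx in xb.
have := @mem_cycle_edges T [:: x; a; b; c] c.
have -> : next [:: x; a; b; c] c = x.
  by rewrite /= ![c == _]eq_sym (negPf xc) (negPf ac) (negPf bc) eqxx.
rewrite E !inE eqxx !orbT setUC => /(_ isT) /(cycle_edges_next U').
rewrite /= eqxx => -[ca|->]; first by rewrite ca eqxx in ac.
by rewrite (negPf xa) (negPf xb') (negPf xc').
Qed.

End UniqueQuadrilaterals.

(** * Interplay of triangles in G and quadrilaterals in H *)

Section Complement.

Variables (T : finType) (e : rel T).
Hypotheses (e_sym : symmetric e) (e_irr : irreflexive e).
Hypothesis P2 : forall f : {set T}, f \in edges e -> in_unique_cycle e 3 f.
Hypothesis P3 : forall f : {set T}, f \in edges (compl e) ->
  in_unique_cycle (compl e) 4 f.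
Implicit Types x y z a b c w : T.

Let e_neq x y : e x y -> x != y.
Proof. by apply: contraTneq => ->; rewrite e_irr. Qed.

Let compl_sym : symmetric (compl e).
Proof. by move=> x y; rewrite /compl eq_sym e_sym. Qed.

Let compl_neq x y : compl e x y -> x != y.
Proof. by case/andP. Qed.

Lemma compl_quadrilateral x a y b : x != y -> a != b ->
  compl e x a -> compl e a y -> compl e y b -> compl e b x ->
  ucycleb (compl e) [:: x; a; y; b].
Proof.
move=> xy ab xa ay yb bx; rewrite /ucycleb /= xa ay yb bx !inE !negb_or.
by rewrite xy ab (eq_sym x b) !compl_neq.
Qed.

(** Three common neighbours [p], [q], [r] would give the quadrilaterals [x p y q] and [x p y r]
    through the edge [x p]. *)
Lemma compl_codegree x y : x != y ->
  #|[set w | compl e x w & compl e y w]| <= 2.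
Proof.
move=> xy; rewrite leqNgt; apply/negP => /card_gt2P[p [q [r [[]]]]].
rewrite !inE => /andP[xp yp] /andP[xq yq] /andP[xr yr] [pq qr rp].
have [||_ qr'] := quadrilateral_unique P3 (x := x) (a := p) (b := y) (c := q)
  (b' := y) (c' := r).
- by apply: compl_quadrilateral => //; rewrite compl_sym.
- by apply: compl_quadrilateral; rewrite // 1?compl_sym // eq_sym.
by rewrite qr' eqxx in qr.
Qed.

Lemma triangle_extra_neighbour x y z : 7 < #|T| -> e x y -> e x z -> e y z ->
  exists a, [/\ e z a, a != x & a != y].
Proof.
move=> T7 exy exz eyz.
case: (pickP [pred a | [&& e z a, a != x & a != y]]) => [a /and3P[]|no].
  by exists a.
pose N u := [set w | compl e u w & compl e z w].
have sub : [set: T] \subset [set x; y] :|: [set z] :|: (N x :|: N y).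
  apply/subsetP => w _; rewrite !inE.
  case: (eqVneq w x) => // wx; case: (eqVneq w y) => // wy.
  case: (eqVneq w z) => //= wz.
  have := no w; rewrite /= wx wy !andbT /compl => ->.
  rewrite !(eq_sym _ w) wx wy wz !andbT /= -negb_and.
  (* Such a [w] would complete the edge [x y] to a triangle, as [z] already does. *)
  apply: contra wz => /andP[exw eyw]; apply/eqP.
  exact: (triangle_unique e_sym e_irr P2 exy).
have := subset_leq_card sub; rewrite cardsT => /(leq_trans T7).
rewrite ltnNge; case/negP.
have -> : 7 = 2 + 1 + (2 + 2) by [].
apply: leq_trans (leq_card_setU _ _) (leq_add _ _).
  apply: leq_trans (leq_card_setU _ _) (leq_add _ _); last by rewrite cards1.
  by rewrite cards2; case: eqP.
apply: leq_trans (leq_card_setU _ _) (leq_add _ _);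
  by apply: compl_codegree; apply: e_neq.
Qed.

Lemma extra_triangle x y z : 7 < #|T| -> e x y -> e x z -> e y z ->
  exists a b, [/\ e z a, e z b, e a b & [/\ compl e x a, compl e x b,
                                           compl e y a & compl e y b]].
Proof.
move=> T7 exy exz eyz.
have ezx : e z x by rewrite e_sym.
have ezy : e z y by rewrite e_sym.
have eyx : e y x by rewrite e_sym.
have third u v w := triangle_unique e_sym e_irr P2 (x := u) (y := v) (z := w).
(* If [u] were joined to [x] in G, the edge [x z] would lie in triangles with third vertices [y] and
   [u]; likewise for [y]. *)
have far u : e z u -> u != x -> u != y -> compl e x u && compl e y u.
  move=> ezu ux uy; rewrite /compl !(eq_sym _ u) ux uy /=.
  apply/andP; split; apply/negP => eu.
    by move/eqP: uy; apply; apply/esym/(third x z).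
  by move/eqP: ux; apply; apply/esym/(third y z).
have [a [eza ax ay]] := triangle_extra_neighbour T7 exy exz eyz.
have [b /andP[ezb eab]] := triangle_exists e_sym P2 eza.
have /andP[xa ya] := far a eza ax ay.
(* This separates [b] from [x] and [y]: they are not joined to [a] in G, while [b] is. *)
have nadj u : compl e u a -> b != u.
  by move=> /andP[_]; apply: contraNneq => <-; rewrite e_sym.
have /andP[xb yb] := far b ezb (nadj x xa) (nadj y ya).
by exists a, b.
Qed.

(** Otherwise [a] and [x] would both complete the edge [u v] to a triangle. *)
Lemma compl_edge_endpoint u v x a : e u v -> e x u -> e x v -> compl e x a ->
  a != u -> a != v -> compl e a u \/ compl e a v.
Proof.
move=> euv exu exv /andP[xa nxa] au av; rewrite /compl au av /=.
apply/orP; rewrite -negb_and; apply: contra xa => /andP[eau eav].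
by apply/eqP/(triangle_unique e_sym e_irr P2 euv); rewrite e_sym.
Qed.

Lemma no_triangle x y z : 7 < #|T| -> e x y -> e x z -> e y z -> False.
Proof.
move=> T7 exy exz eyz.
have eyx : e y x by rewrite e_sym.
have ezx : e z x by rewrite e_sym.
have ezy : e z y by rewrite e_sym.
have [a [a' [eza eza' eaa' [xa xa' ya ya']]]] := extra_triangle T7 exy exz eyz.
have [b [b' [eyb eyb' ebb' [zb zb' xb xb']]]] := extra_triangle T7 ezx ezy exy.
have [c [c' [exc exc' ecc' [yc yc' zc zc']]]] := extra_triangle T7 eyz eyx ezx.
have adj_neq w u v : e w u -> compl e w v -> u != v.
  by move=> ewu /andP[_]; apply: contraNneq => <-.
(* [d] is whichever of [c], [c'] is H-adjacent to [a]; [f] below is whichever of [b], [b'] is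
   H-adjacent to [d]. *)
have [d [exd yd zd ad]] :
    exists d, [/\ e x d, compl e y d, compl e z d & compl e a d].
  have [] := compl_edge_endpoint ecc' exc exc' xa (adj_neq z _ _ eza zc)
    (adj_neq z _ _ eza zc').
    by exists c.
  by exists c'.
have [f [eyf zf xf df]] :
    exists f, [/\ e y f, compl e z f, compl e x f & compl e d f].
  have [] := compl_edge_endpoint ebb' eyb eyb' yd (adj_neq x _ _ exd xb)
    (adj_neq x _ _ exd xb').
    by exists b.
  by exists b'.
(* Comparing [x a y a'] with [x a d f] forces [y = d], but [y] and [d] are H-adjacent. *)
have [||yd' _] := quadrilateral_unique P3 (x := x) (a := a) (b := y) (c := a')
  (b' := d) (c' := f).
- by apply: compl_quadrilateral; rewrite // 1?compl_sym // e_neq.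
- have af := adj_neq z _ _ eza zf.
  by apply: compl_quadrilateral; rewrite // 1?compl_sym // e_neq.
by move: yd; rewrite -yd' => /andP[]; rewrite eqxx.
Qed.

End Complement.

Theorem theorem2 (T : finType) (e : rel T)
  (e_sym : symmetric e) (e_irr : irreflexive e)
  (P2 : forall f : {set T}, f \in edges e -> in_unique_cycle e 3 f)
  (P3 : forall f : {set T}, f \in edges (compl e) ->
          in_unique_cycle (compl e) 4 f) :
  #|T| < 9.
Proof.
rewrite ltnNge; apply/negP => T9; have T7 : 7 < #|T| by apply: ltnW.
case: (pickP (fun p : T * T => e p.1 p.2)) => [[x y] /= exy|no].
  have [z /andP[exz eyz]] := triangle_exists e_sym P2 exy.
  exact: (no_triangle e_sym e_irr P2 P3 T7 exy exz eyz).
(* With no edges in G, H is complete, so [x] and [y] have all [|V| - 2] other vertices as common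
   H-neighbours, more than two. *)
have /card_gt1P[x [y [_ _ xy]]] : 1 < #|T| by apply: leq_trans T7.
have := compl_codegree e_sym P3 xy.
have -> : [set w | compl e x w & compl e y w] = ~: [set x; y].
  apply/setP => w; rewrite !inE /compl (no (x, w)) (no (y, w)) !andbT negb_or.
  by rewrite !(eq_sym _ w).
have := cardsC [set x; y]; rewrite cards2 xy => E /(leq_add (leqnn 2)).
by rewrite E leqNgt (leq_trans _ T7).
Qed.
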